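(* Let $L$ be a primitive Gaussian line. Then $g_L\ge 7$. Moreover, $g_L=7$ if and only if $1+i,\,3,\,1+2i,\,1-2i\in\mathcal{D}(L)$ and the conjugate primes $1+2i$ and $1-2i$ divide consecutive Gaussian integers on $L$, i.e., there is an integer $t$ such that either $1+2i\mid\alpha_t$ and $1-2i\mid\alpha_{t+1}$, or $1-2i\mid\alpha_t$ and $1+2i\mid\alpha_{t+1}$.
   Context: A Gaussian line is a line in the complex plane containing at least two (hence infinitely many) Gaussian integers; it is primitive if it contains two Gaussian integers that are coprime in $\mathbb{Z}[i]$. For a Gaussian line $L$, let $\alpha_0$ be the Gaussian integer on $L$ of minimum norm $N(x+iy)=x^2+y^2$ (if there are two such, take the one with larger real part). If $L$ is vertical, set $\delta=i$; otherwise let $\alpha_1$ be the Gaussian integer on $L$ with $\mathrm{Re}(\alpha_1)>\mathrm{Re}(\alpha_0)$ that is closest to $\alpha_0$, and set $\delta=\alpha_1-\alpha_0$. Then the Gaussian integers on $L$ are exactly $\alpha_m=\alpha_0+m\delta$ for $m\in\mathbb{Z}$. The divisor set $\mathcal{D}(L)$ is the set of Gaussian integers dividing at least one Gaussian integer on $L$. A finite list of Gaussian integers has the property that ''none is coprime to all the others'' if each term shares a common non-unit divisor in $\mathbb{Z}[i]$ with some other term of the list. For a primitive Gaussian line $L$, $g_L$ denotes the smallest integer $n\ge 2$ such that there exist $n$ consecutive terms $\alpha_{k+1},\alpha_{k+2},\dots,\alpha_{k+n}$ of the sequence $(\alpha_0,\alpha_1,\alpha_2,\dots)$ none of which is coprime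 to all the others (such $n$ exists for every primitive Gaussian line). *)

(* Defs.v *)
From mathcomp Require Import all_boot all_order all_algebra.
From mathcomp Require Import complex.
From mathcomp Require Import boolp classical_sets reals constructive_ereal ereal.

Set Implicit Arguments.
Unset Strict Implicit.
Unset Printing Implicit Defensive.

Import Order.TTheory GRing.Theory Num.Theory.

Local Open Scope classical_set_scope.
Local Open Scope complex_scope.
Local Open Scope ring_scope.

Section GaussianLines.
Variable R : realType.
Implicit Types (a b d z : R[i]) (L : set R[i]) (n k : nat).

(* The complex plane is R[i]; the Gaussian integers are a subset of it. *)
Definition gaussint : set R[i] :=
  [set z | complex.Re z \is a Num.int /\ complex.Im z \is a Num.int].

Definition gaussnorm z : R := complex.Re z ^+ 2 + complex.Im z ^+ 2.

(* Divisibility, units and coprimality are those of the ring Z[i],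
   not of the ambient field. *)
Definition gdvd a b : Prop :=
  [/\ gaussint a, gaussint b & exists2 c, gaussint c & b = a * c].

Definition gunit a : Prop := gdvd a 1.

Definition gcoprime a b : Prop :=
  forall d, gdvd d a -> gdvd d b -> gunit d.

Definition line L : Prop :=
  exists a d, d != 0 /\ L = [set a + t%:C * d | t in [set: R]].

Definition gaussian_line L : Prop :=
  line L /\ exists a b, [/\ gaussint a, gaussint b, L a, L b & a != b].

Definition primitive_gaussian_line L : Prop :=
  gaussian_line L /\
  exists a b, [/\ gaussint a, gaussint b, L a, L b & a != b /\ gcoprime a b].

Definition vertical L : Prop :=
  forall a b, L a -> L b -> complex.Re a = complex.Re b.

Definition is_alpha0 L a : Prop :=
  [/\ gaussint a, L a,
      forall b, gaussint b -> L b -> gaussnorm a <= gaussnorm b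
    & forall b, gaussint b -> L b -> gaussnorm b = gaussnorm a ->
        complex.Re b <= complex.Re a].

(* On a Gaussian line the element described is unique; likewise for alpha1
   on a non-vertical one. *)
Definition alpha0 L : R[i] := xget 0 [set a | is_alpha0 L a].

Definition is_alpha1 L a : Prop :=
  [/\ gaussint a, L a, complex.Re (alpha0 L) < complex.Re a
    & forall b, gaussint b -> L b -> complex.Re (alpha0 L) < complex.Re b ->
        `|a - alpha0 L| <= `|b - alpha0 L|].

Definition alpha1 L : R[i] := xget 0 [set a | is_alpha1 L a].

(* 'i%C is Complex 0 1, whereas a bare 'i would be the abstract imaginary unit
   of numClosedFieldType. *)
Definition delta L : R[i] :=
  if `[< vertical L >] then 'i%C else alpha1 L - alpha0 L.

Definition alpha L (m : int) : R[i] := alpha0 L + m%:~R * delta L.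

Definition divisor_set L : set R[i] :=
  [set d | exists a, [/\ gaussint a, L a & gdvd d a]].

(* A list of length n is given as a function on 'I_n: "other" terms are terms
   at another position. *)
Definition none_coprime_to_all_others n (s : 'I_n -> R[i]) : Prop :=
  forall i, exists j, j != i /\
    exists d, [/\ gdvd d (s i), gdvd d (s j) & ~ gunit d].

(* The window starts at any term alpha_k with k : nat, alpha_0 included. *)
Definition window L n : Prop :=
  (2 <= n)%N /\
  exists k, none_coprime_to_all_others (fun i : 'I_n => alpha L (k + i)%N%:Z).

(* Valued in the extended reals, as an infimum, so that the definition does not
   rely on the existence of a suitable n: it is the smallest such n when there
   is one (see gL_eq_nat) and +oo otherwise. *)
Definition gL L : \bar R := ereal_inf [set (n%:R)%:E | n in window L].

Lemma gL_eq_nat L n :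
  gL L = (n%:R)%:E <-> window L n /\ forall m, window L m -> (n <= m)%N.
Proof.
have min m : window L m -> (forall p, window L p -> (m <= p)%N) ->
    gL L = (m%:R)%:E.
  move=> Wm minm; apply/le_anti/andP; split.
    by apply: ereal_inf_lbound; exists m.
  apply: le_ereal_inf_tmp => _ [p Wp <-].
  by rewrite lee_fin ler_nat minm.
split=> [gLn|[]]; last exact: min.
have [/asboolP exW|noW] := boolP `[< exists m, window L m >].
  have exW' : exists m, `[< window L m >].
    by have [m Wm] := exW; exists m; apply/asboolP.
  case: (ex_minnP exW') => m /asboolP Wm minm.
  have {}minm p : window L p -> (m <= p)%N by move=> /asboolP; exact: minm.
  move: gLn; rewrite (min m Wm minm) => -[] /eqP.
  by rewrite eqr_nat => /eqP <-.
move: gLn; rewrite /gL (_ : [set _ | _ in _] = set0) ?ereal_inf0 //.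
apply/seteqP; split=> // x [p Wp _].
by move/asboolP: noW; apply; exists p.
Qed.

End GaussianLines.

(* Main.v *)
Require Import Defs.
From mathcomp Require Import all_boot all_order all_algebra.
From mathcomp Require Import complex.
From mathcomp Require Import boolp classical_sets reals constructive_ereal ereal.
From mathcomp Require Import zify ring lra.

(** Primitivity makes [alpha0] and [delta] coprime in Z[i], so by Bezout a common
    divisor of the terms of indices [i] and [j] divides the integer [i - j].  Taking
    norms, when 0 < |i - j| <= 6 such a non-unit divisor is a multiple of 1+i, 3, 1+2i
    or 1-2i.  Each of these four primes divides the terms of a single residue class
    of indices (mod 2, 3, 5 and 5 respectively), or no term at all.  So whether a window
    of at most 7 terms has the required property depends only on four residues
    relative to its start, and a finite computation leaves, up to exchanging 1+2i and
    1-2i, only length 7 with 1+i, 3 and 1+2i dividing the first term and 1-2i the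
    second one.  Conversely the Chinese remainder theorem produces such a window. *)

Set Implicit Arguments.
Unset Strict Implicit.
Unset Printing Implicit Defensive.

Import Order.TTheory GRing.Theory Num.Theory.

Local Open Scope complex_scope.
Local Open Scope ring_scope.

(** * Arithmetic of the Gaussian integers *)

Lemma intr_complex (R : realType) (m : int) : m%:~R = (m%:~R)%:C :> R[i].
Proof. by rewrite rmorph_int. Qed.

Lemma gaussintP (R : realType) (z : R[i]) :
  gaussint z <-> exists x y : int, z = x%:~R +i* y%:~R.
Proof.
split=> [|[x [y ->]]]; last by split; exact: intr_int.
by case: z => a b [/= /intrP[x ->] /intrP[y ->]]; exists x, y.
Qed.

Lemma gaussint_int (R : realType) (m : int) : gaussint (m%:~R : R[i]).
Proof. by rewrite intr_complex; split; rewrite ?intr_int ?int_num0. Qed.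

Lemma gaussintD (R : realType) (a b : R[i]) :
  gaussint a -> gaussint b -> gaussint (a + b).
Proof. by case: a b => [x y] [u v] [/= ? ?] [/= ? ?]; split=> /=; apply: rpredD. Qed.

Lemma gaussintN (R : realType) (a : R[i]) : gaussint a -> gaussint (- a).
Proof. by case: a => [x y] [/= ? ?]; split=> /=; rewrite rpredN. Qed.

Lemma gaussintB (R : realType) (a b : R[i]) :
  gaussint a -> gaussint b -> gaussint (a - b).
Proof. by move=> ga /gaussintN; exact: gaussintD. Qed.

Lemma gaussintM (R : realType) (a b : R[i]) :
  gaussint a -> gaussint b -> gaussint (a * b).
Proof.
case: a b => [x y] [u v] [/= ? ?] [/= ? ?]; split=> /=.
  by apply: rpredB; apply: rpredM.
by apply: rpredD; apply: rpredM.
Qed.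

Lemma gaussnormM (R : realType) (a b : R[i]) :
  gaussnorm (a * b) = gaussnorm a * gaussnorm b.
Proof. by case: a b => [x y] [u v]; rewrite /gaussnorm /=; ring. Qed.

Lemma gaussnorm_ge0 (R : realType) (a : R[i]) : 0 <= gaussnorm a.
Proof. by rewrite addr_ge0 ?sqr_ge0. Qed.

Lemma gaussnorm_eq0 (R : realType) (a : R[i]) : (gaussnorm a == 0) = (a == 0).
Proof. by case: a => x y; rewrite paddr_eq0 ?sqr_ge0 // !sqrf_eq0 eq_complex. Qed.

Lemma gaussnorm_int (R : realType) (m : int) :
  gaussnorm (m%:~R : R[i]) = (m ^+ 2)%:~R.
Proof. by rewrite intr_complex /gaussnorm /= expr0n addr0 rmorphXn. Qed.

Lemma gaussnorm_gaussint (R : realType) (a : R[i]) :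
  gaussint a -> exists n : nat, gaussnorm a = n%:R.
Proof.
move=> /gaussintP[x [y ->]]; exists (absz (x ^+ 2 + y ^+ 2)).
by rewrite natr_absz ger0_norm ?addr_ge0 ?sqr_ge0 // rmorphD !rmorphXn.
Qed.

(** The norm of a unit is a natural number dividing 1; conversely, when the norm is 1, the conjugate
    is an inverse. *)
Lemma gunit_gaussnorm (R : realType) (a : R[i]) :
  gaussint a -> gunit a <-> gaussnorm a = 1.
Proof.
move=> ga; split=> [[_ _ [c gc ac]]|a1].
  have := gaussnormM a c; rewrite -ac (gaussnorm_int _ 1).
  have [m ->] := gaussnorm_gaussint ga; have [n ->] := gaussnorm_gaussint gc.
  move=> /esym/eqP; rewrite -natrM pnatr_eq1 => /eqP/(congr1 (dvdn m)).
  by rewrite dvdn_mulr // dvdn1 => /esym/eqP ->.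
split=> //; first exact: (gaussint_int _ 1).
exists a^*%C; first by case: (a) ga => x y [/= ? ?]; split=> //=; rewrite rpredN.
case: a a1 {ga} => x y; rewrite /gaussnorm /= => a1.
by apply/eqP; rewrite eq_complex /= -[X in X == _]a1; apply/andP; split; apply/eqP; ring.
Qed.

(** Both coordinates of [a / b] are rounded to a nearest integer. Each error has square at most 1/4,
    so the error has norm at most 1/2 and multiplying it by [b] gives a remainder of smaller norm
    than [b]. *)
Lemma gaussint_edivP (R : realType) (a b : R[i]) :
  gaussint a -> gaussint b -> b != 0 ->
  exists2 q, gaussint q & gaussnorm (a - q * b) < gaussnorm b.
Proof.
move=> ga gb b0; pose z := a / b.
pose r (x : R) := Num.floor (x + 2^-1).
have rP x : (x - (r x)%:~R) ^+ 2 <= 4^-1.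
  have /andP[] := floor_itv (x + 2^-1); rewrite -/(r x) intrD; nra.
exists ((r (complex.Re z))%:~R +i* (r (complex.Im z))%:~R).
  by split; exact: intr_int.
set q := _ +i* _; have -> : a - q * b = (z - q) * b by rewrite mulrBl divfK.
rewrite gaussnormM -[ltRHS]mul1r ltr_pM2r; last first.
  by rewrite lt_neqAle eq_sym gaussnorm_eq0 b0 gaussnorm_ge0.
have := rP (complex.Re z); have := rP (complex.Im z).
rewrite /gaussnorm /q; case: z {q} => x y /=; lra.
Qed.

Lemma gdvdD (R : realType) (d a b : R[i]) : gdvd d a -> gdvd d b -> gdvd d (a + b).
Proof.
move=> [gd ga [u gu ->]] [_ gb [v gv ->]].
rewrite -mulrDr; have guv := gaussintD gu gv.
by split=> //; [exact: gaussintM|exists (u + v)].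
Qed.

Lemma gdvd_mull (R : realType) (d a b : R[i]) :
  gaussint a -> gdvd d b -> gdvd d (a * b).
Proof.
move=> ga [gd gb [u gu ub]]; split=> //; first exact: gaussintM.
by exists (a * u); [exact: gaussintM|rewrite ub; ring].
Qed.

Lemma gdvd_trans (R : realType) (a b c : R[i]) : gdvd a b -> gdvd b c -> gdvd a c.
Proof.
move=> ab [_ _ [u gu ->]]; rewrite mulrC.
exact: gdvd_mull.
Qed.

Lemma gdvdN (R : realType) (d a : R[i]) : gdvd d a -> gdvd d (- a).
Proof. by rewrite -mulN1r; apply/gdvd_mull/(gaussint_int _ (-1)). Qed.

(** Extended Euclidean algorithm, by strong induction on the norm of [b]. *)
Lemma gaussint_bezout (R : realType) (a b : R[i]) : gaussint a -> gaussint b ->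
  exists g u v, [/\ g = u * a + v * b, gaussint u, gaussint v, gdvd g a & gdvd g b].
Proof.
move=> ga gb; have [n] := gaussnorm_gaussint gb.
elim/ltn_ind: n a b ga gb => n IH a b ga gb bn.
have g0 : gaussint (0 : R[i]) := gaussint_int _ 0.
have g1 : gaussint (1 : R[i]) := gaussint_int _ 1.
have [->|b0] := eqVneq b 0.
  exists a, 1, 0; split=> //; first by ring.
    by split=> //; exists 1; rewrite ?mulr1.
  by split=> //; exists 0; rewrite ?mulr0.
have [q gq] := gaussint_edivP ga gb b0.
have gr : gaussint (a - q * b) by apply: gaussintB => //; exact: gaussintM.
have [m rm] := gaussnorm_gaussint gr; rewrite rm bn ltr_nat => mn.
have [g [u [v [guv gu gv dgb dgr]]]] := IH m mn b _ gb gr rm.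
exists g, v, (u - v * q); split=> //; first by rewrite guv; ring.
  by apply: gaussintB => //; exact: gaussintM.
by rewrite -(subrK (q * b) a); apply: gdvdD => //; exact: gdvd_mull.
Qed.

(** Let [g] be a gcd of [d] and [e]. Dividing [e] and [a + i e], it divides [a], so it is a unit by
    coprimality. Since [d] divides [(i - j) e], it divides [(i - j) g], hence [i - j]. *)
Lemma common_gdvd (R : realType) (a e d : R[i]) (i j : int) :
  gaussint e -> gcoprime a e ->
  gdvd d (a + i%:~R * e) -> gdvd d (a + j%:~R * e) -> gdvd d (i - j)%:~R.
Proof.
move=> ge cop di dj; have [gd _ _] := di.
have [g [u [v [guv gu gv dgd dge]]]] := gaussint_bezout gd ge.
have ug : gunit g.
  apply: cop => //; rewrite -(addrK (i%:~R * e) a); apply: gdvdD.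
    exact: gdvd_trans di.
  by apply/gdvdN/gdvd_mull => //; exact: gaussint_int.
have dg : gdvd d ((i - j)%:~R * g).
  (* Expand [g = u d + v e] and write [(i - j) e] as the difference of the two terms. *)
  have -> : (i - j)%:~R * g = (i - j)%:~R * u * d +
      v * ((a + i%:~R * e) + - (a + j%:~R * e)).
    by rewrite guv intrB; ring.
  apply: gdvdD; last by apply: gdvd_mull => //; exact/gdvdD/gdvdN.
  apply: gdvd_mull; first by apply: gaussintM => //; exact: gaussint_int.
  split=> //; exists 1; last by rewrite mulr1.
  exact: (gaussint_int _ 1).
have [_ _ [c gc gc1]] := ug.
have -> : (i - j)%:~R = c * ((i - j)%:~R * g).
  by rewrite mulrCA [c * g]mulrC -gc1 mulr1.
exact: gdvd_mull.
Qed.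

(** * Gaussian divisors of small rational integers *)

Lemma gdvd_gaussnorm (R : realType) (d : R[i]) (m : nat) (n : int) :
  gaussnorm d = m%:R -> gdvd d n%:~R -> (m %| `|n| ^ 2)%N.
Proof.
move=> dm [_ _ [c /gaussnorm_gaussint[k ck] /(congr1 (@gaussnorm R))]].
rewrite gaussnormM gaussnorm_int dm ck -natrM -[X in X%:~R]gez0_abs ?sqr_ge0 //.
by move=> /eqP; rewrite eqr_nat abszX => /eqP ->; exact: dvdn_mulr.
Qed.

(* Each prime is paired with the rational prime it divides. *)
Definition small_primes (R : realType) : seq (nat * R[i]) :=
  [:: (2%N, 1 + 'i%C); (3%N, 3); (5%N, 1 + 2 * 'i%C); (5%N, 1 - 2 * 'i%C)].

Lemma small_primesE (R : realType) :
  small_primes R = [:: (2%N, 1 +i* 1); (3%N, 3 +i* 0); (5%N, 1 +i* 2); (5%N, 1 +i* (-2))].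
Proof.
have natE n : n%:R = n%:R +i* 0 :> R[i].
  by rewrite -[LHS](rmorph_nat (real_complex R)).
have E2 : 1 + 2 * 'i%C = 1 +i* 2 :> R[i].
  by rewrite natE; apply/eqP; rewrite eq_complex /=; apply/andP; split; apply/eqP; ring.
have E2' : 1 - 2 * 'i%C = 1 +i* (-2) :> R[i].
  by rewrite natE; apply/eqP; rewrite eq_complex /=; apply/andP; split; apply/eqP; ring.
have E1 : 1 + 'i%C = 1 +i* 1 :> R[i].
  by apply/eqP; rewrite eq_complex /=; apply/andP; split; apply/eqP; ring.
by rewrite /small_primes E1 E2 E2' -natE.
Qed.

(** The exponent handles all four primes at once: the norm is the paired prime itself, except that 3
    is inert and has norm 9. *)
Lemma gaussnorm_small_primes (R : realType) (p : nat * R[i]) :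
  p \in small_primes R ->
  prime p.1 /\ exists e, gaussnorm p.2 = (p.1 ^ e.+1)%:R.
Proof.
rewrite small_primesE !inE => /or4P[] /eqP -> /=; split=> //.
- by exists 0%N; rewrite natrX /gaussnorm /=; ring.
- by exists 1%N; rewrite natrX /gaussnorm /=; ring.
- by exists 0%N; rewrite natrX /gaussnorm /=; ring.
- by exists 0%N; rewrite natrX /gaussnorm /=; ring.
Qed.

Lemma gaussint_small_primes (R : realType) (p : nat * R[i]) :
  p \in small_primes R -> gaussint p.2.
Proof.
rewrite small_primesE !inE => /or4P[] /eqP -> /=; split;
by rewrite /= ?rpredN ?natr_int ?rpred0 ?rpred1.
Qed.

(** By norms, [p.1] divides [n ^ 2], hence [n]. Conversely [p.2] divides [p.1], with the cofactors
    read off 2 = (1+i)(1-i), 3 = 3 * 1 and 5 = (1+2i)(1-2i). *)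
Lemma gdvd_small_primes_int (R : realType) (p : nat * R[i]) (n : int) :
  p \in small_primes R -> gdvd p.2 n%:~R <-> (p.1 %| `|n|)%N.
Proof.
move=> ps; have [pp [e pn]] := gaussnorm_small_primes ps; split=> [/(gdvd_gaussnorm pn) h|].
  move: (dvdn_trans (dvdn_exp2l _ (ltn0Sn _)) h).
  by rewrite expn1 Euclid_dvdX // andbT.
move=> /dvdnP[k nk].
have -> : n = Num.sg n * k%:Z * p.1%:Z by rewrite {1}(numEsg n) -mulrA -PoszM -nk.
rewrite intrM; apply: gdvd_mull; first exact: gaussint_int.
split; [exact: gaussint_small_primes|exact: gaussint_int|].
move: ps; rewrite small_primesE !inE => /or4P[] /eqP -> /=; rewrite intr_complex.
- exists (1 +i* (-1)); first by split; rewrite /= ?rpredN ?rpred1.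
  by apply/eqP; rewrite eq_complex /=; apply/andP; split; apply/eqP; ring.
- exists (1 +i* 0); first by split; rewrite /= ?rpred0 ?rpred1.
  by apply/eqP; rewrite eq_complex /=; apply/andP; split; apply/eqP; ring.
- exists (1 +i* (-2)); first by split; rewrite /= ?rpredN ?rpred1 ?natr_int.
  by apply/eqP; rewrite eq_complex /=; apply/andP; split; apply/eqP; ring.
- exists (1 +i* 2); first by split; rewrite /= ?rpredN ?rpred1 ?natr_int.
  by apply/eqP; rewrite eq_complex /=; apply/andP; split; apply/eqP; ring.
Qed.

(** Squares are 0 or 1 modulo 3, so two of them sum to 0 only when both vanish. *)
Lemma dvd3_sum_sqr (x y k : int) : x ^+ 2 + y ^+ 2 = 3 * k ->
  exists s t, x = 3 * s /\ y = 3 * t.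
Proof.
have mod3 (z : int) : exists s, [\/ z = 3 * s, z = 3 * s + 1 | z = 3 * s - 1].
  have : [|| (z %% 3)%Z == 0, (z %% 3)%Z == 1 | (z %% 3)%Z == 2] by lia.
  by case/or3P => /eqP h; [exists (z %/ 3)%Z; apply: Or31
    | exists (z %/ 3)%Z; apply: Or32 | exists ((z %/ 3)%Z + 1); apply: Or33]; lia.
have [s sP] := mod3 x; have [t tP] := mod3 y => h.
exists s, t; rewrite !expr2 in h.
by case: sP => xs; case: tP => yt; subst x y; split; lia.
Qed.

(** Modulo 5 the sum is [x ^ 2 - 4 y ^ 2 = (x + 2 y) (x - 2 y)]. The factor divisible by 5 decides
    which of 1+2i (first case) and 1-2i (second case) divides x+iy. *)
Lemma dvd5_sum_sqr (x y k : int) : x ^+ 2 + y ^+ 2 = 5 * k ->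
  exists s, x = 5 * s - 2 * y \/ x = 5 * s + 2 * y.
Proof.
move=> h; have : (5 %| (x + 2 * y) * (x - 2 * y))%Z.
  by apply/dvdzP; exists (k - y ^+ 2); rewrite !expr2 in h *; lia.
rewrite dvdzE abszM Euclid_dvdM // => /orP[] h5.
  by have /dvdzP[s xs] : (5 %| x + 2 * y)%Z by []; exists s; left; lia.
by have /dvdzP[s xs] : (5 %| x - 2 * y)%Z by []; exists s; right; lia.
Qed.

(** When [q] divides the norm, the coordinates satisfy a linear congruence modulo [q] that makes the
    quotient by one of the listed primes integral. The witnesses below are these quotients. *)
Lemma small_prime_gdvd (R : realType) (d : R[i]) (m q : nat) :
  gaussint d -> gaussnorm d = m%:R -> (q %| m)%N -> q \in [:: 2; 3; 5]%N ->
  exists2 p, p \in small_primes R & gdvd p.2 d.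
Proof.
move=> gd dm /dvdnP[k mk]; have [x [y dxy]] := (gaussintP d).1 gd.
have {dm}xym : x ^+ 2 + y ^+ 2 = q%:Z * k%:Z.
  rewrite -PoszM mulnC -mk; apply: (@intr_inj R).
  by rewrite rmorphD !rmorphXn -[RHS]/(m%:R) -dm dxy.
rewrite small_primesE dxy !inE => /or3P[] /eqP q_eq; rewrite q_eq in xym.
- have [s xs] : exists s, x = 2 * s - y by exists ((x + y) %/ 2)%Z; nia.
  exists (2%N, 1 +i* 1); first by rewrite inE eqxx.
  split; [by split; rewrite /= ?rpred1|by split; exact: intr_int|].
  exists (s%:~R +i* (y - s)%:~R); first by split; exact: intr_int.
  apply/eqP; rewrite eq_complex /= xs.
  by apply/andP; split; apply/eqP; rewrite !(intrB, intrM); ring.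
- have [s [t [xs yt]]] := dvd3_sum_sqr xym.
  exists (3%N, 3 +i* 0); first by rewrite !inE eqxx orbT.
  split; [by split; rewrite /= ?rpred0 ?natr_int|by split; exact: intr_int|].
  exists (s%:~R +i* t%:~R); first by split; exact: intr_int.
  apply/eqP; rewrite eq_complex /= xs yt.
  by apply/andP; split; apply/eqP; rewrite !intrM; ring.
- have [s [xs|xs]] := dvd5_sum_sqr xym.
  exists (5%N, 1 +i* 2); first by rewrite !inE eqxx !orbT.
  split; [by split; rewrite /= ?rpred1 ?natr_int|by split; exact: intr_int|].
  exists (s%:~R +i* (y - 2 * s)%:~R); first by split; exact: intr_int.
  apply/eqP; rewrite eq_complex /= xs.
  by apply/andP; split; apply/eqP; rewrite !(intrD, intrB, intrM); ring.
exists (5%N, 1 +i* (- 2)); first by rewrite !inE eqxx !orbT.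
split; [by split; rewrite /= ?rpredN ?rpred1 ?natr_int|by split; exact: intr_int|].
exists (s%:~R +i* (y + 2 * s)%:~R); first by split; exact: intr_int.
apply/eqP; rewrite eq_complex /= xs.
by apply/andP; split; apply/eqP; rewrite !(intrD, intrB, intrM); ring.
Qed.

(** The norm of [d] exceeds 1 and divides [n ^ 2], so its least prime factor divides [n] and can
    only be 2, 3 or 5. *)
Lemma common_small_prime (R : realType) (d : R[i]) (n : int) :
  n != 0 -> (`|n| <= 6)%N -> gdvd d n%:~R -> ~ gunit d ->
  exists2 p, p \in small_primes R & gdvd p.2 d.
Proof.
move=> n0 n6 dn nud; have [gd _ _] := dn.
have [m dm] := gaussnorm_gaussint gd; have mn := gdvd_gaussnorm dm dn.
have m1 : (1 < m)%N.
  have m0 : (0 < m)%N by rewrite (dvdn_gt0 _ mn) // expn_gt0 absz_gt0 n0.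
  rewrite ltn_neqAle m0 andbT; apply/eqP => m1; apply: nud.
  by apply/gunit_gaussnorm; rewrite // dm -m1.
apply: (small_prime_gdvd gd dm (pdiv_dvd m)).
have := pdiv_prime m1; have := dvdn_trans (pdiv_dvd m) mn.
move: (pdiv m) => q; move=> qn q_pr; move: qn; rewrite Euclid_dvdX // andbT => qn.
have q6 : (q <= 6)%N by apply: leq_trans n6; rewrite dvdn_leq // absz_gt0.
by move: q q6 q_pr {qn}; do 7!case=> //.
Qed.

(** * Gaussian integers on a Gaussian line *)

Lemma line_translate (R : realType) (L : set R[i]) (a b c : R[i]) (t : R) :
  line L -> L a -> L b -> L c -> L (c + t%:C * (b - a)).
Proof.
move=> [p [d [_ ->]]] [s _ <-] [u _ <-] [v _ <-]; exists (v + t * (u - s)) => //.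
by rewrite rmorphD rmorphM rmorphB; ring.
Qed.

Lemma line_param (R : realType) (L : set R[i]) (a b z : R[i]) :
  line L -> L a -> L b -> a != b -> L z -> exists t : R, z = a + t%:C * (b - a).
Proof.
move=> [p [d [_ ->]]] [s _ <-] [u _ <-] ab [v _ <-].
have us : u - s != 0.
  by apply: contraNneq ab => /eqP; rewrite subr_eq0 => /eqP ->.
exists ((v - s) / (u - s)).
have -> : p + u%:C * d - (p + s%:C * d) = (u - s)%:C * d by rewrite rmorphB; ring.
by rewrite mulrA -rmorphM divfK // rmorphB; ring.
Qed.

(** As [alpha0] is picked by [xget], it suffices to exhibit one suitable point; two successive
    minimizations over natural numbers give it, first of the norm, then for the real part. *)
Lemma is_alpha0_alpha0 (R : realType) (L : set R[i]) :
  gaussian_line L -> is_alpha0 L (alpha0 L).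
Proof.
move=> [_ [a [_ [ga _ La _ _]]]]; apply: xgetPex.
pose P n := `[< exists z, [/\ gaussint z, L z & gaussnorm z = n%:R] >].
have exP : exists n, P n.
  by have [n an] := gaussnorm_gaussint ga; exists n; apply/asboolP; exists a.
case: (ex_minnP exP) => n /asboolP[b [gb Lb bn]] minn.
(* A Gaussian integer of norm [n] has integral real part [x <= x ^ 2 <= n], so maximizing [x]
   amounts to minimizing the natural number [n - x]. *)
have Re_le (z : R[i]) : gaussint z -> gaussnorm z = n%:R ->
    exists k : nat, complex.Re z = n%:R - k%:R.
  move=> /gaussintP[x [y ->]] zn.
  have xyn : x ^+ 2 + y ^+ 2 = n%:Z.
    apply: (@intr_inj R); rewrite rmorphD !rmorphXn.
    exact: zn.
  have xn : 0 <= n%:Z - x by rewrite -xyn; nia.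
  exists `|n%:Z - x|%N; rewrite natr_absz ger0_norm // intrB /= -pmulrn.
  by ring.
pose Q k := `[< exists z,
  [/\ gaussint z, L z, gaussnorm z = n%:R & complex.Re z = n%:R - k%:R] >].
have exQ : exists k, Q k.
  by have [k bk] := Re_le b gb bn; exists k; apply/asboolP; exists b.
case: (ex_minnP exQ) => k /asboolP[c [gc Lc cn ck]] mink.
exists c; split=> // z gz Lz.
  have [m zm] := gaussnorm_gaussint gz.
  by rewrite zm cn ler_nat minn //; apply/asboolP; exists z.
rewrite cn => zn; have [m zm] := Re_le z gz zn.
by rewrite zm ck lerD2l lerN2 ler_nat mink //; apply/asboolP; exists z.
Qed.

Lemma is_alpha1_alpha1 (R : realType) (L : set R[i]) :
  gaussian_line L -> ~ vertical L -> is_alpha1 L (alpha1 L).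
Proof.
move=> gL nvL; have [lL [a [b [ga gb La Lb ab]]]] := gL.
have [g0 L0 _ _] := is_alpha0_alpha0 gL.
have Rab : complex.Re (b - a) != 0.
  apply/eqP => Rab; apply: nvL => u v Lu Lv.
  have [s ->] := line_param lL La Lb ab Lu; have [t ->] := line_param lL La Lb ab Lv.
  case: (b - a) Rab => x y /= ->; case: (a) => p q /=; ring.
apply: xgetPex.
pose P n := `[< exists z, [/\ gaussint z, L z,
  complex.Re (alpha0 L) < complex.Re z & gaussnorm (z - alpha0 L) = n%:R] >].
have exP : exists n, P n.
  (* Since [b - a] has nonzero real part, adding it to or subtracting it from [alpha0 L] moves to
     the right. *)
  suff [z [gz Lz z0]] : exists z, [/\ gaussint z, L z & complex.Re (alpha0 L) < complex.Re z].
    have [n zn] := gaussnorm_gaussint (gaussintB gz g0).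
    by exists n; apply/asboolP; exists z.
  have L0e t := line_translate t lL La Lb L0.
  have gba := gaussintB gb ga.
  have [Rba|Rba] : 0 < complex.Re (b - a) \/ complex.Re (b - a) < 0.
    by apply/orP; rewrite orbC -neq_lt.
    exists (alpha0 L + (b - a)); split; first exact: gaussintD.
      by rewrite -[b - a]mul1r; exact: (L0e 1).
    by case: (alpha0 L) (b - a) Rba => [? ?] [? ?] /=; lra.
  exists (alpha0 L - (b - a)); split; first exact: gaussintB.
    by rewrite -[b - a]mul1r -mulNr -(rmorphN1 (real_complex R)); exact: L0e.
  by case: (alpha0 L) (b - a) Rba => [? ?] [? ?] /=; lra.
case: (ex_minnP exP) => n /asboolP[c [gc Lc c0 cn]] minn.
exists c; split=> // z gz Lz z0.
rewrite !normc_def lecR ler_wsqrtr // -[leLHS]/(gaussnorm _) -[leRHS]/(gaussnorm _) cn.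
have [m zm] := gaussnorm_gaussint (gaussintB gz g0).
by rewrite zm ler_nat minn //; apply/asboolP; exists z.
Qed.

(** The last clause is what makes [delta] a generator of the Gaussian translations along the line.
    If [delta] is i, then [t] would be an integer; otherwise [alpha0 + t delta] would be a Gaussian
    integer to the right of [alpha0] and closer to it than [alpha1]. *)
Lemma delta_min (R : realType) (L : set R[i]) : gaussian_line L ->
  [/\ gaussint (delta L), delta L != 0, L (alpha0 L + delta L)
    & forall t : R, 0 < t < 1 -> ~ gaussint (t%:C * delta L)].
Proof.
move=> gL; have [lL [p [q [gp gq Lp Lq pq]]]] := gL.
have [g0 L0 _ _] := is_alpha0_alpha0 gL.
rewrite /delta; case: asboolP => [vL|/(is_alpha1_alpha1 gL)[g1 L1 Re01 min1]].
  split.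
  - by split; rewrite /= ?rpred0 ?rpred1.
  - by rewrite eq_complex /= oner_eq0 andbF.
  - have Rpq := vL _ _ Lp Lq.
    have Ipq : complex.Im q - complex.Im p != 0.
      apply: contraNneq pq => /eqP; rewrite subr_eq0 => /eqP Ipq.
      by rewrite eq_complex Rpq Ipq !eqxx.
    (* On a vertical line, i is [q - p] divided by the difference of the imaginary parts. *)
    have := line_translate (complex.Im q - complex.Im p)^-1 lL Lp Lq L0.
    congr (L (_ + _)); case: p q Rpq Ipq {gp gq Lp Lq pq} => [x y] [u v] /= -> yv.
    apply/eqP; rewrite eq_complex /= !mul0r subrr mulr0 subr0 addr0 eqxx.
    by rewrite mulVf ?eqxx.
  - move=> t t01 [_ /=]; rewrite !(mul0r, mulr1, mulr0, addr0) => /intrP[m tm].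
    by move: t01; rewrite tm ltr0z ltrz1; lia.
set d := alpha1 L - alpha0 L.
have d0 : d != 0.
  by rewrite subr_eq0; apply: contraTneq Re01 => ->; rewrite ltxx.
split=> //; first exact: gaussintB.
  by rewrite /d addrC subrK.
move=> t /andP[t0 t1] gtd.
have Red : 0 < complex.Re d.
  by rewrite /d; case: (alpha1 L) (alpha0 L) Re01 => [? ?] [? ?] /=; rewrite subr_gt0.
have Re0 : complex.Re (alpha0 L) < complex.Re (alpha0 L + t%:C * d).
  have -> (a e : R[i]) : complex.Re (a + t%:C * e) = complex.Re a + t * complex.Re e.
    by case: a e => [? ?] [? ?] /=; rewrite mul0r subr0.
  by rewrite ltrDl mulr_gt0.
have := min1 _ (gaussintD g0 gtd) (line_translate t lL L0 L1 L0) Re0.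
rewrite (addrC (alpha0 L) (_ * _)) addrK normrM -/d.
suff lt : `|t%:C| * `|d| < `|d| by move=> /(lt_le_trans lt); rewrite ltxx.
rewrite -[ltRHS]mul1r ltr_pM2r ?normr_gt0 // normc_def /= expr0n addr0 sqrtr_sqr.
by rewrite ger0_norm ?(ltW t0) // ltcR.
Qed.

(** Write [z = alpha0 + t delta]. The fractional part of [t] times [delta] is a Gaussian integer, so
    by [delta_min] that fractional part is zero. *)
Lemma alphaP (R : realType) (L : set R[i]) (z : R[i]) : gaussian_line L ->
  (gaussint z /\ L z) <-> exists m, z = alpha L m.
Proof.
move=> gL; have [lL _] := gL; have [g0 L0 _ _] := is_alpha0_alpha0 gL.
have [gd d0 L1 mind] := delta_min gL.
have dE : delta L = alpha0 L + delta L - alpha0 L by rewrite addrC addKr.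
have ga m : gaussint (alpha L m).
  by apply: gaussintD => //; apply: gaussintM => //; exact: gaussint_int.
split=> [[gz Lz]|[m ->]]; last first.
  split=> //; rewrite /alpha intr_complex dE; exact: line_translate.
have [|t zt] := line_param lL L0 L1 _ Lz.
  by rewrite -subr_eq0 opprD addNKr oppr_eq0.
rewrite -dE in zt; exists (Num.floor t).
have gf : gaussint ((t - (Num.floor t)%:~R)%:C * delta L).
  have -> : (t - (Num.floor t)%:~R)%:C * delta L = z - alpha L (Num.floor t).
    by rewrite zt /alpha intr_complex rmorphB; ring.
  exact: gaussintB.
have /andP[f0 f1] := floor_itv t; rewrite intrD in f1.
have [tf|tf] := eqVneq t (Num.floor t)%:~R.
  by rewrite zt /alpha intr_complex -tf.
exfalso; apply: mind gf; rewrite subr_gt0 lt_neqAle eq_sym tf f0 /=.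
by rewrite ltrBlDl.
Qed.

(** A common divisor divides every [alpha L m], in particular the coprime pair given by
    primitivity. *)
Lemma gcoprime_alpha0_delta (R : realType) (L : set R[i]) :
  primitive_gaussian_line L -> gcoprime (alpha0 L) (delta L).
Proof.
move=> [gL [a [b [ga gb La Lb [_ cop]]]]] d d0 dd.
have da m : gdvd d (alpha L m).
  by apply: gdvdD => //; apply: gdvd_mull => //; exact: gaussint_int.
have [m am] := (alphaP a gL).1 (conj ga La).
have [n bn] := (alphaP b gL).1 (conj gb Lb).
by apply: cop; rewrite ?am ?bn.
Qed.

Lemma divisor_set_alpha (R : realType) (L : set R[i]) (d : R[i]) :
  gaussian_line L -> divisor_set L d <-> exists m, gdvd d (alpha L m).
Proof.
move=> gL; split=> [[a [ga La da]]|[m dm]].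
  by have [m am] := (alphaP a gL).1 (conj ga La); exists m; rewrite -am.
have [gm Lm] := (alphaP (alpha L m) gL).2 (ex_intro _ m erefl).
by exists (alpha L m).
Qed.

(** * Windows of at most seven terms *)

Lemma gdvd_alpha_congr (R : realType) (L : set R[i]) (p : nat * R[i]) (m n : int) :
  primitive_gaussian_line L -> p \in small_primes R -> gdvd p.2 (alpha L m) ->
  gdvd p.2 (alpha L n) <-> (p.1 %| `|n - m|)%N.
Proof.
move=> pL ps dm; have [gL _] := pL; have [gd _ _ _] := delta_min gL.
rewrite -(gdvd_small_primes_int _ ps); split=> [dn|dnm].
  exact: common_gdvd gd (gcoprime_alpha0_delta pL) dn dm.
have -> : alpha L n = alpha L m + delta L * (n - m)%:~R.
  by rewrite /alpha intrB; ring.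
by apply: gdvdD => //; exact: gdvd_mull.
Qed.

(* The residue [r p = p.1], which no index has, encodes that [p.2] divides no
   term. *)
Lemma alpha_residues (R : realType) (L : set R[i]) (k : nat) :
  primitive_gaussian_line L ->
  exists r : nat * R[i] -> nat, forall p, p \in small_primes R ->
    (r p <= p.1)%N /\
    forall i : nat, gdvd p.2 (alpha L (k + i)%N%:Z) <-> (i %% p.1 = r p)%N.
Proof.
move=> pL.
suff /choice[r rP] : forall p, exists c, p \in small_primes R ->
    (c <= p.1)%N /\
    forall i : nat, gdvd p.2 (alpha L (k + i)%N%:Z) <-> (i %% p.1 = c)%N.
  by exists r.
move=> p; have [ps|_] := boolP (p \in small_primes R); last by exists 0%N.
have [/prime_gt0 p0 _] := gaussnorm_small_primes ps.
have [[m dm]|ndvd] := pselect (exists m, gdvd p.2 (alpha L m)); last first.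
  exists p.1 => _; split=> // i; split=> [di|ip]; first by case: ndvd; exists (k + i)%N%:Z.
  by have := ltn_pmod i p0; rewrite ip ltnn.
have mod_ge0 : (0 <= (m - k%:Z) %% p.1%:Z)%Z by rewrite modz_ge0 // -lt0n.
(* Indices are counted from the start [k] of the window, hence the shift of [m] by [k]. *)
exists `|((m - k%:Z) %% p.1%:Z)%Z|%N => _; split=> [|i].
  by rewrite -lez_nat gez0_abs // ltW // ltz_pmod.
rewrite (gdvd_alpha_congr _ pL ps dm) -[X in X <-> _]/(is_true (p.1%:Z %| _)%Z).
have -> : (k + i)%N%:Z - m = i%:Z - (m - k%:Z) by lia.
rewrite -eqz_mod_dvd modz_nat -[X in _ == X]gez0_abs // eqz_nat.
by split=> /eqP.
Qed.

(** Computable model of a window: a pair (q, c) stands for a prime dividing exactly the terms whose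
    index in the window is c modulo q. *)
Definition cover (n : nat) (cs : seq (nat * nat)) : bool :=
  all (fun i => has (fun j => (j != i) &&
    has (fun c => (i %% c.1 == c.2)%N && (j %% c.1 == c.2)%N) cs) (iota 0 n)) (iota 0 n).

(** Two indices of the window differ by at most 6, so a common non-unit divisor of two terms yields
    a common small prime. Conversely, small primes are not units. *)
Lemma none_coprime_cover (R : realType) (L : set R[i]) (n k : nat)
    (r : nat * R[i] -> nat) :
  primitive_gaussian_line L -> (n <= 7)%N ->
  (forall p, p \in small_primes R -> forall i : nat,
    gdvd p.2 (alpha L (k + i)%N%:Z) <-> (i %% p.1 = r p)%N) ->
  none_coprime_to_all_others (fun i : 'I_n => alpha L (k + i)%N%:Z) <->
  cover n [seq (p.1, r p) | p <- small_primes R].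
Proof.
move=> pL n7 rP; have [gL _] := pL; have [gd _ _ _] := delta_min gL; split.
  move=> H; apply/allP => i; rewrite mem_iota add0n => /andP[_ ni].
  have [j [ji [d [di dj nud]]]] := H (Ordinal ni).
  apply/hasP; exists (val j); first by rewrite mem_iota /= add0n.
  rewrite (_ : (val j != i) = (j != Ordinal ni)) // ji andTb.
  have dij := common_gdvd gd (gcoprime_alpha0_delta pL) di dj.
  have [] := common_small_prime _ _ dij nud.
  - by move: ji; rewrite -(inj_eq val_inj) /=; lia.
  - by have := ltn_ord j; rewrite /=; lia.
  move=> p ps pd; apply/hasP; exists (p.1, r p); first by apply/mapP; exists p.
  by apply/andP; split; apply/eqP/(rP p ps); exact: gdvd_trans pd _.
move=> /allP H i.
have /H/hasP[j] : val i \in iota 0 n by rewrite mem_iota add0n /=.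
rewrite mem_iota add0n => /andP[_ nj] /andP[ji /hasP[_ /mapP[p ps ->]]].
move=> /andP[/eqP/(rP p ps) pi /eqP/(rP p ps) pj].
exists (Ordinal nj); split; first by rewrite -(inj_eq val_inj).
exists p.2; split=> // /gunit_gaussnorm; have [pp [e ->]] := gaussnorm_small_primes ps.
move=> /(_ (gaussint_small_primes ps))/eqP; rewrite pnatr_eq1 => /eqP p1.
by have := dvdn_exp (ltn0Sn e) (dvdnn p.1); rewrite p1 Euclid_dvd1.
Qed.

(** Exhaustive evaluation. The bounds include the moduli themselves, which encode a prime dividing
    no term. *)
Lemma cover_le7 (n a b c d : nat) :
  (2 <= n <= 7)%N -> (a <= 2)%N -> (b <= 3)%N -> (c <= 5)%N -> (d <= 5)%N ->
  cover n [:: (2, a); (3, b); (5, c); (5, d)]%N =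
  [&& n == 7, a == 0, b == 0 & ((c, d) == (0, 1)) || ((c, d) == (1, 0))]%N.
Proof.
have /allP H : (all (fun n => all (fun a => all (fun b => all (fun c => all (fun d =>
  cover n [:: (2, a); (3, b); (5, c); (5, d)] ==
  [&& n == 7, a == 0, b == 0 & ((c, d) == (0, 1)) || ((c, d) == (1, 0))])
  (iota 0 6)) (iota 0 6)) (iota 0 4)) (iota 0 3)) (iota 2 6))%N by vm_compute.
move=> n27 a2 b3 c5 d5.
have /H/allP{}H : n \in iota 2 6 by rewrite mem_iota; lia.
have /H/allP{}H : a \in iota 0 3 by rewrite mem_iota; lia.
have /H/allP{}H : b \in iota 0 4 by rewrite mem_iota; lia.
have /H/allP{}H : c \in iota 0 6 by rewrite mem_iota; lia.
by have /H/eqP : d \in iota 0 6 by rewrite mem_iota; lia.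
Qed.

Lemma none_coprime_le7 (R : realType) (L : set R[i]) (n k : nat) :
  primitive_gaussian_line L -> (2 <= n <= 7)%N ->
  none_coprime_to_all_others (fun i : 'I_n => alpha L (k + i)%N%:Z) <->
  [/\ n = 7%N, gdvd (1 + 'i%C) (alpha L k), gdvd 3 (alpha L k)
    & (gdvd (1 + 2 * 'i%C) (alpha L k) /\ gdvd (1 - 2 * 'i%C) (alpha L (k%:Z + 1))) \/
      (gdvd (1 - 2 * 'i%C) (alpha L k) /\ gdvd (1 + 2 * 'i%C) (alpha L (k%:Z + 1)))].
Proof.
move=> pL n27; have [_ n7] := andP n27; have [r rP] := alpha_residues k pL.
rewrite (none_coprime_cover pL n7 (fun p ps => (rP p ps).2)) /=.
have [] := rP (2%N, 1 + 'i%C); first by rewrite !inE eqxx.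
move: (r _) => a a2 /= aP.
have [] := rP (3%N, 3); first by rewrite !inE eqxx !orbT.
move: (r _) => b b3 /= bP.
have [] := rP (5%N, 1 + 2 * 'i%C); first by rewrite !inE eqxx !orbT.
move: (r _) => c c5 /= cP.
have [] := rP (5%N, 1 - 2 * 'i%C); first by rewrite !inE eqxx !orbT.
move: (r _) => d d5 /= dP.
(* The surviving residues are 0 and 1, so offsets 0 and 1 suffice to translate them into
   divisibility of the first two terms. *)
rewrite cover_le7 //; move: (aP 0%N) (bP 0%N) (cP 0%N) (dP 0%N) (cP 1%N) (dP 1%N).
rewrite !addn0 !PoszD !mod0n => A B C D C1 D1; split.
  case/and4P => /eqP n_eq7 /eqP a0 /eqP b0 cd; subst a b.
  split=> //; [exact/A|exact/B|].
  by case/orP: cd => /eqP[? ?]; subst c d;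
    [left; split; [exact/C|exact/D1]|right; split; [exact/D|exact/C1]].
by case=> -> /A <- /B <- [[/C <- /D1 <-]|[/D <- /C1 <-]].
Qed.

(** * The lower bound 7 and the case of equality *)

Theorem theorem6 (R : realType) (L : set R[i]) (hL : primitive_gaussian_line L) :
  (7%:E <= gL L)%E /\
  (gL L = 7%:E <->
    [/\ divisor_set L (1 + 'i%C), divisor_set L 3,
        divisor_set L (1 + 2 * 'i%C), divisor_set L (1 - 2 * 'i%C)
      & exists t : int,
          (gdvd (1 + 2 * 'i%C) (alpha L t) /\ gdvd (1 - 2 * 'i%C) (alpha L (t + 1))) \/
          (gdvd (1 - 2 * 'i%C) (alpha L t) /\ gdvd (1 + 2 * 'i%C) (alpha L (t + 1)))]).
Proof.
have [gaussL _] := hL.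
have window_ge7 n : window L n -> (7 <= n)%N.
  move=> [n2 [k W]]; rewrite leqNgt; apply/negP => n7.
  have [|n_eq7 _ _ _] := (none_coprime_le7 k hL _).1 W; first by rewrite n2 ltnW.
  by rewrite n_eq7 in n7.
split.
  apply: le_ereal_inf_tmp => _ [n Wn <-].
  by rewrite lee_fin ler_nat window_ge7.
(* Minimality of 7 is already known from [window_ge7], so only existence of a window remains. *)
have -> : gL L = 7%:E <-> window L 7.
  by rewrite (gL_eq_nat L 7); split=> [[]|].
split=> [[_ [k]]|[]].
  rewrite none_coprime_le7 // => -[_ d2 d3 d5]; split; last by exists k%:Z.
  - by apply/divisor_set_alpha => //; exists k.
  - by apply/divisor_set_alpha => //; exists k.
  - by apply/divisor_set_alpha => //; case: d5 => -[? ?]; [exists k|exists (k%:Z + 1)].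
  - by apply/divisor_set_alpha => //; case: d5 => -[? ?]; [exists (k%:Z + 1)|exists k].
move=> /(divisor_set_alpha _ gaussL)[m2 d2] /(divisor_set_alpha _ gaussL)[m3 d3] _ _ [t d5].
have transfer (p : nat * R[i]) (m n : int) : p \in small_primes R ->
    gdvd p.2 (alpha L m) -> (n = m %[mod p.1])%Z -> gdvd p.2 (alpha L n).
  move=> ps dm nm; apply/(gdvd_alpha_congr _ hL ps dm).
  by apply: (_ : (p.1%:Z %| _)%Z); rewrite -eqz_mod_dvd; apply/eqP.
(* Chinese remainders: 15, 10 and 6 are 1 modulo 2, 3 and 5 respectively, and 0 modulo the other
   two. Reducing modulo 30 makes the start nonnegative, as a window requires. *)
pose k := absz ((15 * m2 + 10 * m3 + 6 * t) %% 30)%Z.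
have k2 : (k%:Z = m2 %[mod 2%N])%Z by lia.
have k3 : (k%:Z = m3 %[mod 3%N])%Z by lia.
have k5 : (k%:Z = t %[mod 5%N])%Z by lia.
have k51 : (k%:Z + 1 = t + 1 %[mod 5%N])%Z by lia.
split=> //; exists k; rewrite none_coprime_le7 //; split=> //.
- by apply: (transfer (2%N, _)) k2; rewrite // !inE eqxx.
- by apply: (transfer (3%N, _)) k3; rewrite // !inE eqxx !orbT.
- case: d5 => -[dt dt1]; [left|right]; split.
  + by apply: (transfer (5%N, _)) k5; rewrite // !inE eqxx !orbT.
  + by apply: (transfer (5%N, _)) k51; rewrite // !inE eqxx !orbT.
  + by apply: (transfer (5%N, _)) k5; rewrite // !inE eqxx !orbT.
  + by apply: (transfer (5%N, _)) k51; rewrite // !inE eqxx !orbT.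
Qed.
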